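(* There exists a universal constant $c>0$ such that the following holds. For any positive integer $k$, any positive $\mu_k,D,\epsilon$, and any deterministic algorithm based on a $k$-th order oracle, with initialization point $\mathbf{w}_1$, there exists a function $f:\mathbb{R}^d\to\mathbb{R}$ (for some finite $d$) such that: (i) $f$ is convex, $k$ times differentiable, $k$-order smooth (i.e. $\|\nabla^kf(\mathbf{u})-\nabla^kf(\mathbf{v})\|\leq\mu_k\|\mathbf{u}-\mathbf{v}\|$ for all $\mathbf{u},\mathbf{v}\in\mathbb{R}^d$), and has a global minimum $\mathbf{w}^*$ satisfying $\|\mathbf{w}_1-\mathbf{w}^*\|\leq D$; (ii) any index $T$ for which the point $\mathbf{w}_T$ produced by the algorithm on $f$ satisfies $f(\mathbf{w}_T)-f(\mathbf{w}^* )\leq\epsilon$ must satisfy $$T\;\geq\; c\left(\frac{\mu_kD^{k+1}}{(k+1)!\,k\,\epsilon}\right)^{2/(3k+1)}.$$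
   Context: A $k$-th order oracle for $f$, given a point $\mathbf{w}$, returns the value of $f$ and all its derivatives up to order $k$: $f(\mathbf{w}),\nabla f(\mathbf{w}),\nabla^2f(\mathbf{w}),\ldots,\nabla^kf(\mathbf{w})$. A deterministic algorithm based on such an oracle produces a sequence of points $\mathbf{w}_1,\mathbf{w}_2,\ldots$ in $\mathbb{R}^d$, where each $\mathbf{w}_t$ is a deterministic function of the oracle's responses at $\mathbf{w}_1,\ldots,\mathbf{w}_{t-1}$ (so $\mathbf{w}_1$ is fixed before any oracle call). The dimension $d$ is not fixed in advance and may depend on the other problem parameters; an algorithm is understood to be specified for every dimension $d$. Vector norms are Euclidean; the norm of a symmetric $k$-th order tensor $A$ is the operator norm $\|A\|=\max_{\|\mathbf{x}\|=1}\left|\sum_{i_1,\ldots,i_k}A_{i_1,\ldots,i_k}x_{i_1}\cdots x_{i_k}\right|$. *)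

(* Defs.v *)
From HB Require Import structures.
From mathcomp Require Import all_boot all_order all_algebra.
From mathcomp Require Import all_classical all_reals all_analysis.

Set Implicit Arguments.
Unset Strict Implicit.
Unset Printing Implicit Defensive.

Import Order.TTheory GRing.Theory Num.Theory.
Import numFieldNormedType.Exports.

Local Open Scope classical_set_scope.
Local Open Scope ring_scope.

(* The library norm `|x| on 'rV[R]_d is the sup norm, hence this definition.
   Differentiability in the library sense is unaffected by the choice of norm. *)
Definition enorm (R : realType) (d : nat) (x : 'rV[R]_d) : R :=
  Num.sqrt (\sum_(i < d) x 0 i ^+ 2).

(* Order-j tensors, given by their entries A_{i_1,...,i_j}. *)
Definition tensor (R : realType) (j d : nat) : Type :=
  {ffun j.-tuple 'I_d -> R}.

(* \sum_{i_1,...,i_j} A_{i_1,...,i_j} x_{i_1} ... x_{i_j} *)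
Definition tform (R : realType) (j d : nat) (A : tensor R j d)
    (x : 'rV[R]_d) : R :=
  \sum_(s : j.-tuple 'I_d) A s * \prod_(l < j) x 0 (tnth s l).

(* For d > 0 the supremum is a maximum, the unit sphere being compact and
   nonempty. *)
Definition opnorm (R : realType) (j d : nat) (A : tensor R j d) : R :=
  sup [set `|tform A x| | x in [set x : 'rV[R]_d | enorm x = 1]].

(* pderiv f [:: i_1; ...; i_j] is the iterated partial derivative
   \partial_{i_1} ... \partial_{i_j} f. *)
Fixpoint pderiv (R : realType) (d : nat) (f : 'rV[R]_d -> R^o) (s : seq 'I_d)
    : 'rV[R]_d -> R^o :=
  if s is i :: s' then fun w => 'D_(delta_mx 0 i) (pderiv f s') w else f.

Definition nabla (R : realType) (j d : nat) (f : 'rV[R]_d -> R^o)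
    (w : 'rV[R]_d) : tensor R j d :=
  [ffun s : j.-tuple 'I_d => pderiv f s w].

(* In coordinates, f is k times (Frechet) differentiable on R^d when all its
   iterated partial derivatives of order < k exist and are themselves
   differentiable everywhere. *)
Definition times_differentiable (R : realType) (k d : nat)
    (f : 'rV[R]_d -> R^o) : Prop :=
  forall s : seq 'I_d, (size s < k)%N ->
  forall w : 'rV[R]_d, differentiable (pderiv f s) w.

Definition order_smooth (R : realType) (k d : nat) (mu : R)
    (f : 'rV[R]_d -> R^o) : Prop :=
  forall u v : 'rV[R]_d,
    opnorm (nabla k f u - nabla k f v) <= mu * enorm (u - v).

(* The answer of a k-th order oracle: one tensor of each order j = 0, ..., k,
   the one of order 0 being the value of the function. *)
Definition response (R : realType) (k d : nat) : Type :=
  forall j : 'I_k.+1, tensor R j d.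

Definition oracle (R : realType) (k d : nat) (f : 'rV[R]_d -> R^o)
    (w : 'rV[R]_d) : response R k d :=
  fun j => nabla j f w.

(* A deterministic algorithm, specified in every dimension d, maps the list of
   the responses at w_1, ..., w_{t-1} (oldest first) to w_t; the index t is
   determined by the length of the list. *)
Definition algorithm (R : realType) (k : nat) : Type :=
  forall d : nat, seq (response R k d) -> 'rV[R]_d.

Definition init_point (R : realType) (k : nat) (alg : algorithm R k) (d : nat)
    : 'rV[R]_d :=
  alg d [::].

(* The responses at w_1, ..., w_t. *)
Fixpoint transcript (R : realType) (k : nat) (alg : algorithm R k) (d : nat)
    (f : 'rV[R]_d -> R^o) (t : nat) : seq (response R k d) :=
  if t is t'.+1 then
    let h := transcript alg f t' in rcons h (oracle f (alg d h))
  else [::].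

(* w_t, meaningful for t >= 1. *)
Definition iterate (R : realType) (k : nat) (alg : algorithm R k) (d : nat)
    (f : 'rV[R]_d -> R^o) (t : nat) : 'rV[R]_d :=
  alg d (transcript alg f t.-1).

(* Main.v *)
Require Import Defs.
From HB Require Import structures.
From mathcomp Require Import all_boot all_order all_algebra.
From mathcomp Require Import all_classical all_reals all_analysis.
From mathcomp Require Import ring lra zify.
Import Order.TTheory GRing.Theory Num.Theory.
Import numFieldNormedType.Exports.
Local Open Scope classical_set_scope.
Local Open Scope ring_scope.
Set Implicit Arguments.
Unset Strict Implicit.
Unset Printing Implicit Defensive.

(** The hard functions are chains of one-sided powers along an orthonormal
    family v_0, ..., v_{n-1}, continued by v_i = 0 for i >= n:

      f(w) = alpha * sum_{i<n} (<v_i - v_{i+1}, w>)_+^{k+1} - beta * <v_0, w>.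

    Locality ([chain_local]).  A power of exponent k+1 vanishes at 0 together
    with its derivatives of order at most k.  Hence at a point orthogonal to
    v_t, v_{t+1}, ... the answer of a k-th order oracle involves v_0, ..., v_t
    only.  An adversary can therefore choose v_t after seeing the query w_t
    (counted from 0), orthogonal to all queries and directions so far, without
    contradicting any earlier answer; so each query w_t is orthogonal to every
    v_i with i >= t ([adversary]).  In dimension 2n a fresh direction is always
    available.

    Gap.  Put beta = alpha (k+1) delta^k.  Bounding each power below by its
    tangent at delta makes the sum telescope: if <v_t, w> = 0 then
    f(w) >= - t alpha k delta^{k+1} ([chain_ge]).  With t = n this bounds f
    everywhere, and the bound is attained where <v_i, w> = (n-i) delta
    ([chain_at_minimizer]).  Since v_i is orthogonal to w_0, such a point
    exists at squared distance sum_i (i delta)^2 <= n^3 delta^2 from w_0.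
    So n^3 delta^2 = D^2 is a legitimate choice, and the first n/2 queries all
    miss the minimum by at least (n/2) alpha k delta^{k+1}.

    Smoothness ([chain_smooth]).  The k-th derivative is a sum of k-th powers of
    the linear forms v_i - v_{i+1} whose coefficients are Lipschitz with
    constant alpha (k+1)!.  By Bessel's inequality these forms satisfy
    sum_i <v_i - v_{i+1}, x>^2 <= 4 |x|^2, so by Cauchy-Schwarz the k-th
    derivative is Lipschitz with constant alpha (k+1)! 2^{k+1}; this is mu for
    the right alpha.

    Finally n = 2N, with N just above X = M^{2/(3k+1)} / 64 for
    M = mu D^{k+1} / ((k+1)! k eps), makes the gap exceed eps
    ([chain_length_bound], [gap_exceeds]): the square of the gap is at least
    M^2 eps^2 N^{-(3k+1)} / 32^{k+1}, and the constant 1/64 absorbs the factor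
    32^{k+1}, because 32^{k+1} <= 32^{3k+1}. *)

(** * Powers of the positive part *)

Section PositivePart.
Variable R : realType.
Implicit Types x y m : R.

Definition ppow (p : nat) (y : R) : R := Num.max 0 y ^+ p.

Lemma ppow_ge0 p y : 0 <= ppow p y.
Proof. by rewrite exprn_ge0 // le_max lexx. Qed.

Lemma ppow_nneg p y : 0 <= y -> ppow p y = y ^+ p.
Proof. by move=> y0; rewrite /ppow max_r. Qed.

Lemma ppow_npos p y : y <= 0 -> ppow p.+1 y = 0.
Proof. by move=> y0; rewrite /ppow max_l // expr0n. Qed.

Lemma ppowS p y : ppow p.+2 y = y * ppow p.+1 y.
Proof.
have [y0|/ltW y0] := leP 0 y; first by rewrite !ppow_nneg // exprS.
by rewrite !ppow_npos // mulr0.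
Qed.

(** Induction on the exponent: multiplying the bound for p by x leaves exactly
    the bound for p+1 plus the square term p m^(p-1) (x - m)^2. *)
Lemma expr_tangent p x m : 0 <= x -> 0 <= m ->
  m ^+ p.+1 + p.+1%:R * m ^+ p * (x - m) <= x ^+ p.+1.
Proof.
move=> x0 m0; elim: p => [|p IH].
  by rewrite !expr1 expr0 mulr1 mul1r addrC subrK.
rewrite [x ^+ _]exprS; apply: le_trans (ler_wpM2l x0 IH); rewrite -subr_ge0.
rewrite [leRHS](_ : _ = p.+1%:R * m ^+ p * (x - m) ^+ 2).
  by apply: mulr_ge0 (sqr_ge0 _); apply: mulr_ge0; rewrite ?ler0n ?exprn_ge0.
rewrite !exprS -(natr1 p.+1); ring.
Qed.

(** The tangent bound holds on the whole line, which makes the power convex and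
    lets the chain be bounded below termwise.  The exponent must be at least 2:
    with exponent 1 the formula fails at negative points m, where ppow 0
    is 1 and not the slope of the positive part. *)
Lemma ppow_tangent p y m :
  ppow p.+2 m + p.+2%:R * ppow p.+1 m * (y - m) <= ppow p.+2 y.
Proof.
have [m0|/ltW m0] := leP 0 m; last first.
  by rewrite !(ppow_npos _ m0) mulr0 mul0r addr0 ppow_ge0.
rewrite !(ppow_nneg _ m0); apply: le_trans (expr_tangent p.+1 _ m0); last first.
  by rewrite le_max lexx.
rewrite lerD2l ler_wpM2l ?mulr_ge0 ?ler0n ?exprn_ge0 // lerD2r.
by rewrite le_max lexx orbT.
Qed.

Lemma ppow1_lipschitz x y : `|ppow 1 x - ppow 1 y| <= `|x - y|.
Proof.
rewrite /ppow !expr1 /Num.max ler_distl; apply/andP.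
have := ler_norm (x - y); have := ler_norm (y - x); rewrite (distrC y x).
by case: ltP => ?; case: ltP => ?; split; lra.
Qed.

Lemma ppow_convex p (t : R) x y : 0 <= t <= 1 ->
  ppow p.+2 (t * x + (1 - t) * y) <= t * ppow p.+2 x + (1 - t) * ppow p.+2 y.
Proof.
move=> /andP[t0 t1]; set m := t * x + _.
have t1' : 0 <= 1 - t by rewrite subr_ge0.
have := lerD (ler_wpM2l t0 (ppow_tangent p x m))
             (ler_wpM2l t1' (ppow_tangent p y m)).
by apply: le_trans; rewrite le_eqVlt; apply/orP; left; apply/eqP; rewrite /m; ring.
Qed.

(** The only derivative that needs care at 0: the error of the first order
    expansion is at most h^2, whatever the signs of y and y + h. *)
Lemma is_derive_ppow2 y : is_derive y 1 (ppow 2 : R^o -> R^o) (2 * ppow 1 y).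
Proof.
suff H : (fun h => h^-1 *: ((ppow 2 \o shift y) (h *: (1 : R^o)) - ppow 2 y))
    @ (0 : R)^' --> (2 * ppow 1 y).
  by apply: DeriveDef; [apply/cvg_ex; exists (2 * ppow 1 y)|apply/cvg_lim].
apply/cvgrPdist_le => /= e e0; near=> h.
have h0 : h != 0 by near: h; exact: nbhs_dnbhs_neq.
have he : `|h| <= e by near: h; exact: dnbhs0_le.
rewrite /shift /= [h *: _]mulr1 [_ *: _]mulrC.
have key : `|ppow 2 (h + y) - ppow 2 y - 2 * ppow 1 y * h| <= `|h| ^+ 2.
  rewrite real_normK ?num_real // /ppow expr1 ler_norml.
  by rewrite /Num.max; case: ltP => ?; case: ltP => ?; apply/andP; split; nra.
rewrite -normrN opprB.
rewrite (_ : _ - _ = (ppow 2 (h + y) - ppow 2 y - 2 * ppow 1 y * h) / h);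
  last by field.
rewrite normrM normfV ler_pdivrMr ?normr_gt0 //.
by rewrite (le_trans key) // expr2 ler_wpM2r.
Unshelve. all: by end_near. Qed.

(** Higher exponents follow from the product rule and [ppowS]. *)
Lemma is_derive_ppow p y :
  is_derive y 1 (ppow p.+2 : R^o -> R^o) (p.+2%:R * ppow p.+1 y).
Proof.
elim: p y => [|p IH] y; first exact: is_derive_ppow2.
have -> : (ppow p.+3 : R^o -> R^o) = (id : R^o -> R^o) * (ppow p.+2 : R^o -> R^o).
  by apply/funext => x; rewrite ppowS.
apply: (is_derive_eq (is_deriveM (is_derive_id y 1) (IH y))).
rewrite ![_ *: _]mulrC mul1r ppowS -(natr1 p.+2); ring.
Qed.

End PositivePart.

(** * The Euclidean inner product *)

Section Euclidean.
Variables (R : realType) (d : nat).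
Implicit Types (a u v w x : 'rV[R]_d).

Definition dot a w : R^o := \sum_(i < d) a 0 i * w 0 i.

Fact dot_is_linear a : linear (dot a).
Proof.
move=> c u w; rewrite /dot scaler_sumr -big_split; apply: eq_bigr => i _ /=.
by rewrite !mxE mulrDr mulrCA.
Qed.

HB.instance Definition _ a :=
  GRing.isLinear.Build R 'rV[R]_d R^o *:%R (dot a) (dot_is_linear a).

Lemma dotC a w : dot a w = dot w a.
Proof. by apply: eq_bigr => i _; rewrite mulrC. Qed.

Lemma dot_delta a i : dot a (delta_mx 0 i) = a 0 i.
Proof.
rewrite /dot (bigD1 i) //= mxE !eqxx mulr1 big1 ?addr0 // => j /negbTE ji.
by rewrite mxE ji mulr0.
Qed.

Lemma dot_ge0 x : 0 <= dot x x.
Proof. by apply: sumr_ge0 => i _; rewrite -expr2 sqr_ge0. Qed.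

Lemma enorm_sqr x : enorm x ^+ 2 = dot x x.
Proof. by rewrite sqr_sqrtr // sumr_ge0 // => i _; rewrite sqr_ge0. Qed.

Lemma dot_orthonormal_sum n (v : nat -> 'rV[R]_d) (c : nat -> R) i :
  (forall i j, (i < n)%N -> (j < n)%N -> dot (v i) (v j) = (i == j)%:R) ->
  (i < n)%N -> dot (v i) (\sum_(j < n) c j *: v j) = c i.
Proof.
move=> vv ni; rewrite linear_sum (bigD1 (Ordinal ni)) //= linearZ /= vv // eqxx.
rewrite big1 ?addr0 => [|j ji]; first by rewrite [LHS]mulr1.
rewrite linearZ /= vv // eq_sym (_ : (_ == _) = false); last exact/negbTE.
by rewrite [LHS]mulr0.
Qed.

(** The residual x - y after projecting x on the family has norm
    |x|^2 - sum_i <v_i, x>^2, which is nonnegative. *)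
Lemma bessel n (v : nat -> 'rV[R]_d) x :
  (forall i j, (i < n)%N -> (j < n)%N -> dot (v i) (v j) = (i == j)%:R) ->
  \sum_(i < n) dot (v i) x ^+ 2 <= dot x x.
Proof.
move=> vv; pose y := \sum_(i < n) dot (v i) x *: v i.
have vy i : (i < n)%N -> dot (v i) y = dot (v i) x.
  exact: (dot_orthonormal_sum (fun j => dot (v j) x)).
have yz z : dot y z = \sum_(i < n) dot (v i) x * dot (v i) z.
  rewrite dotC linear_sum; apply: eq_bigr => i _.
  by rewrite linearZ /= (dotC z).
have yE : dot y y = \sum_(i < n) dot (v i) x ^+ 2.
  by rewrite yz; apply: eq_bigr => i _; rewrite vy.
have := dot_ge0 (x - y).
rewrite linearB /= dotC [dot (x - y) y]dotC !linearB /= yE (dotC x y).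
have -> : dot y x = \sum_(i < n) dot (v i) x ^+ 2.
  by rewrite yz; apply: eq_bigr => i _; rewrite expr2.
by rewrite subrr addr0 subr_ge0.
Qed.

(** * Sums of ridge functions and their derivatives *)

Lemma dot_continuous a : continuous (dot a).
Proof.
apply: (continuous_big (op := +%R)) => [|i _]; first exact: add_continuous.
move=> w; apply: (@continuousM R _ (cst (a 0 i)) (fun x => x 0 i) w).
  exact: cst_continuous.
exact: coord_continuous.
Qed.

(** The chain rule for a function that varies in the single direction a. *)
Lemma is_derive_ridge (phi : R^o -> R^o) (dphi : R) a w :
  is_derive (dot a w) 1 phi dphi ->
  differentiable (fun z => phi (dot a z)) w /\
  forall v, is_derive w v (fun z => phi (dot a z)) (dphi * dot a v).
Proof.
move=> [/derivable1_diffP dp vp].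
have dd : differentiable (dot a) w.
  exact/linear_differentiable/dot_continuous.
have dc : differentiable (phi \o dot a) w by exact: differentiable_comp.
split=> // v; apply: DeriveDef; first exact: diff_derivable.
rewrite deriveE // diff_comp //= diff_lin; last exact: dot_continuous.
rewrite -vp [in RHS]deriveE //= -[X in 'd _ _ X](mulr1 (dot a v)).
rewrite -[dot a v * 1]/(dot a v *: (1 : R^o)).
by rewrite linearZ /= mulrC.
Qed.

Lemma ridge_scaled_derivative (phi : R^o -> R^o) (dphi : R) a w :
  is_derive (dot a w) 1 phi dphi -> forall (c : R) v,
  differentiable (fun z => phi (dot a z) * c : R^o) w /\
  is_derive w v (fun z => phi (dot a z) * c : R^o) (dphi * dot a v * c).
Proof.
move=> dp c v; have [H1 H2] := is_derive_ridge dp.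
have -> : (fun z => phi (dot a z) * c : R^o) = c *: (fun z => phi (dot a z)).
  by apply/funext => z; rewrite mulrC.
split; first exact: differentiableZ.
by rewrite mulrC; exact: is_deriveZ (H2 v).
Qed.

(** Distributivity: the k-th tensor power of a, evaluated at x, is <a, x>^k. *)
Lemma tform_power k a x :
  \sum_(s : k.-tuple 'I_d)
    (\prod_(l <- s) a 0 l) * \prod_(l < k) x 0 (tnth s l)
  = dot a x ^+ k.
Proof.
rewrite -[k in RHS]card_ord -prodr_const bigA_distr_bigA /=.
rewrite [RHS](reindex (@finfun_of_tuple 'I_d k)) /=; last first.
  exists (@tuple_of_finfun 'I_d k) => f _;
    [exact: finfun_of_tupleK|exact: tuple_of_finfunK].
apply: eq_bigr => s _; rewrite big_tuple -big_split.
by apply: eq_bigr => l _; rewrite /= !ffunE.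
Qed.

Section RidgeSum.
Variables (n k : nat) (a : 'I_n -> 'rV[R]_d) (phi : 'I_n -> nat -> R^o -> R^o).
Hypothesis is_derive_phi : forall i j (y : R^o), (j < k)%N ->
  is_derive y (1 : R^o) (phi i j) (phi i j.+1 y).

(** Each derivative along a coordinate l brings down a factor a_i(l), so the
    tensor of order j is sum_i phi_i^(j)(<a_i, w>) times the j-th tensor power
    of a_i. *)
Lemma pderiv_ridge :
  forall s : seq 'I_d, (size s <= k)%N ->
  pderiv (fun w => \sum_i phi i 0 (dot (a i) w)) s =
  (fun w => \sum_i phi i (size s) (dot (a i) w) * \prod_(l <- s) a i 0 l).
Proof.
elim=> [|l s IH] sk.
  by apply/funext => w /=; apply: eq_bigr => i _; rewrite big_nil mulr1.
apply/funext => w; rewrite [LHS]/= IH 1?ltnW //.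
have dF i := ridge_scaled_derivative (is_derive_phi i (dot (a i) w) sk)
  (\prod_(j <- s) a i 0 j).
rewrite -(fct_sumE _ _ (fun i z => phi i (size s) (dot (a i) z) * _)) derive_sum;
  last by move=> i; have [_ []] := dF i (delta_mx 0 l).
apply: eq_bigr => i _; have [_ []] := dF i (delta_mx 0 l) => _ ->.
by rewrite dot_delta big_cons -mulrA.
Qed.

Lemma times_differentiable_ridge :
  times_differentiable k (fun w => \sum_i phi i 0 (dot (a i) w)).
Proof.
move=> s sk w; rewrite (pderiv_ridge (ltnW sk)).
rewrite -(fct_sumE _ _ (fun i z => phi i (size s) (dot (a i) z) * _)).
apply: differentiable_sum => i.
by have [] := ridge_scaled_derivative (is_derive_phi i (dot (a i) w) sk)
  (\prod_(j <- s) a i 0 j) 0.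
Qed.

Lemma tform_nabla_ridge u v x :
  let F := fun w => \sum_i phi i 0 (dot (a i) w) in
  tform (nabla k F u - nabla k F v) x =
  \sum_i (phi i k (dot (a i) u) - phi i k (dot (a i) v)) * dot (a i) x ^+ k.
Proof.
move=> F; rewrite /tform.
under eq_bigr => s _.
  rewrite !ffunE !pderiv_ridge ?size_tuple // -sumrB mulr_suml.
  under eq_bigr => i _ do rewrite -mulrBl -mulrA.
  over.
rewrite exchange_big /=; apply: eq_bigr => i _.
by rewrite -mulr_sumr tform_power.
Qed.

End RidgeSum.

(** Nonemptiness of the unit sphere is what the positive dimension is for. *)
Lemma opnorm_le k (A : tensor R k d) (B : R) : (0 < d)%N ->
  (forall x, enorm x = 1 -> `|tform A x| <= B) -> opnorm A <= B.
Proof.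
move=> d0 AB; apply: ge_sup; last by move=> _ [x x1 <-]; exact: AB.
exists `|tform A (delta_mx 0 (Ordinal d0))|.
exists (delta_mx 0 (Ordinal d0)) => //=.
rewrite /enorm (bigD1 (Ordinal d0)) //= mxE !eqxx big1 ?addr0 ?expr1n ?sqrtr1 //.
by move=> j /negbTE jd; rewrite mxE jd /= expr0n.
Qed.

End Euclidean.

(** * The chain function *)

Section Chain.
Variables (R : realType) (d : nat) (k n : nat) (alpha beta : R).
Hypothesis k_gt0 : (0 < k)%N.
Implicit Types (v : nat -> 'rV[R]_d) (u w x : 'rV[R]_d).

(** The linear term and the n powers form one sum of ridge functions: index 0 is
    the linear term, index i+1 the power along v_i - v_{i+1}. *)
Definition chain_dir v (i : nat) : 'rV[R]_d :=
  if i is i'.+1 then v i' - v i else v 0.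

(** The j-th derivative of the i-th profile, correct for j <= k only: at order
    k+1 the positive part has no derivative at 0. *)
Definition chain_profile (i j : nat) (y : R^o) : R^o :=
  if i is _.+1 then alpha * (k.+1 ^_ j)%:R * ppow (k.+1 - j) y
  else match j with 0 => - beta * y | 1 => - beta | _ => 0 end.

Definition chain v w : R^o :=
  \sum_(i < n.+1) chain_profile i 0 (dot (chain_dir v i) w).

Lemma chainE v w : chain v w =
  alpha * (\sum_(i < n) ppow k.+1 (dot (v i - v i.+1) w)) - beta * dot (v 0) w.
Proof.
rewrite /chain big_ord_recl /= addrC mulNr; congr (_ - _).
by rewrite [RHS]mulr_sumr; apply: eq_bigr => i _; rewrite subn0 ffactn0 mulr1.
Qed.

Lemma is_derive_chain_profile (i : 'I_n.+1) j (y : R^o) : (j < k)%N ->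
  is_derive y (1 : R^o) (chain_profile i j) (chain_profile i j.+1 y).
Proof.
move=> jk; case: (nat_of_ord i) => [|i'] /=.
  case: j jk => [|[|j]] jk.
  - apply: (is_derive_eq (is_deriveZ (- beta) (is_derive_id y (1 : R^o)))).
    by rewrite [LHS]mulr1.
  - exact: is_derive_cst.
  - exact: is_derive_cst.
rewrite /chain_profile subSS (_ : (k.+1 - j = (k - j.+1).+2)%N); last by lia.
set c := alpha * _.
apply: (is_derive_eq (is_deriveZ c (is_derive_ppow (k - j.+1) y))).
rewrite ffactnSr natrM [LHS]mulrA -/c (_ : (k.+1 - j = (k - j.+1).+2)%N); last by lia.
by rewrite (_ : (k - j = (k - j.+1).+1)%N) ?mulrA //; lia.
Qed.

Lemma chain_times_differentiable v : times_differentiable k (chain v).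
Proof.
exact: (times_differentiable_ridge (fun i : 'I_n.+1 => chain_dir v i)
  is_derive_chain_profile).
Qed.

(** The terms of index at most t depend on v_0, ..., v_t only.  In the later ones
    the argument of the power is 0 at w, and k+1-j >= 1 kills the j-th
    derivative for every j <= k. *)
Lemma chain_local v v' t w :
  (forall i, (i <= t)%N -> v i = v' i) ->
  (forall i, (t <= i)%N -> dot (v i) w = 0) ->
  (forall i, (t <= i)%N -> dot (v' i) w = 0) ->
  oracle (k:=k) (chain v) w = oracle (k:=k) (chain v') w.
Proof.
move=> vv' vw v'w; apply: functional_extensionality_dep => -[j jk].
apply/ffunP => s; rewrite !ffunE /=.
rewrite !(pderiv_ridge _ is_derive_chain_profile) ?size_tuple //.
apply: eq_bigr => -[[|i] /= _] _; first by rewrite vv'.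
have [ti|it] := leqP t i; last by rewrite !vv' // ltnW.
rewrite !(dotC _ w) !linearB /= -!(dotC _ w) !vw ?v'w ?(leqW ti) // subrr.
by rewrite subSn // ppow_npos // !mulr0 !mul0r.
Qed.

Lemma chain_convex v : 0 <= alpha ->
  convex_function [set: convex_lmodType 'rV[R]_d] (chain v).
Proof.
move=> alpha0 t x y _ _; set s : R := t%:num.
have s01 : 0 <= s <= 1 by rewrite /s ge0 le1.
have dot_conv a :
    dot a (conv t x y) = s * dot a x + (1 - s) * dot a y.
  by rewrite -[conv t x y]/(s *: x + (1 - s) *: y) linearD !linearZ.
rewrite -[leRHS]/(s * chain v x + (1 - s) * chain v y) !chainE dot_conv.
rewrite [leRHS](_ : _ = alpha * \sum_(i < n)
    (s * ppow k.+1 (dot (v i - v i.+1) x)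
     + (1 - s) * ppow k.+1 (dot (v i - v i.+1) y))
  - beta * (s * dot (v 0) x + (1 - s) * dot (v 0) y)); last first.
  by rewrite big_split /= -!mulr_sumr; ring.
rewrite lerD2r ler_wpM2l // ler_sum // => i _; rewrite dot_conv.
by case: (k) k_gt0 => // k' _; exact: ppow_convex.
Qed.

(** The zero tail encodes both the boundary condition v_n = 0 of the full chain and
    the directions not yet chosen in a partial one. *)
Definition orthonormal_upto v :=
  (forall i j, (i < n)%N -> (j < n)%N -> dot (v i) (v j) = (i == j)%:R) /\
  (forall i, (n <= i)%N -> v i = 0).

(** From (p - q)^2 <= 2 p^2 + 2 q^2 and Bessel's inequality for the family and for
    its shift. *)
Lemma sum_dot_diff_sqr v x : orthonormal_upto v ->
  \sum_(i < n) dot (v i - v i.+1) x ^+ 2 <= 4 * dot x x.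
Proof.
move=> [vv v0]; have B := bessel x vv.
have B1 : \sum_(i < n) dot (v i.+1) x ^+ 2 <= dot x x.
  apply: le_trans B.
  have E : \sum_(i < n.+1) dot (v i) x ^+ 2
         = dot (v 0) x ^+ 2 + \sum_(i < n) dot (v i.+1) x ^+ 2.
    by rewrite big_ord_recl.
  move: E; rewrite big_ord_recr /= (v0 n) // (dotC 0) linear0 expr0n addr0 => ->.
  by rewrite lerDr sqr_ge0.
have H : \sum_(i < n) dot (v i - v i.+1) x ^+ 2 <=
    2 * (\sum_(i < n) dot (v i) x ^+ 2) + 2 * (\sum_(i < n) dot (v i.+1) x ^+ 2) :> R.
  rewrite !mulr_sumr -big_split /=; apply: ler_sum => i _.
  rewrite !(dotC _ x) linearB /=; set p : R := dot x _; set q : R := dot x _.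
  have : 0 <= (p + q) ^+ 2 by exact: sqr_ge0.
  by nra.
apply: le_trans H _.
move: B B1; set S1 : R := \sum_(i < n) _; set S2 : R := \sum_(i < n) _.
by set D : R := dot x x; move=> *; lra.
Qed.

Lemma sqr_sum_entry (a : 'I_n -> R) (A : R) i : 0 <= A ->
  \sum_i a i ^+ 2 <= A ^+ 2 -> `|a i| <= A.
Proof.
move=> A0 aA; rewrite -(@ler_pXn2r _ 2) ?nnegrE // real_normK ?num_real //.
apply: le_trans aA.
by rewrite (bigD1 i) //= lerDl sumr_ge0 // => j _; rewrite sqr_ge0.
Qed.

(** Cauchy-Schwarz, from 2 A B |p_i q_i| <= B^2 p_i^2 + A^2 q_i^2; this needs
    A B > 0, hence the separate treatment of a zero bound. *)
Lemma sum_norm_mul_le (p q : 'I_n -> R) (A B : R) : 0 <= A -> 0 <= B ->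
  \sum_i p i ^+ 2 <= A ^+ 2 -> \sum_i q i ^+ 2 <= B ^+ 2 ->
  \sum_i `|p i| * `|q i| <= A * B.
Proof.
move=> A0 B0 pA qB; have [Az|An0] := eqVneq A 0.
  rewrite Az mul0r big1 // => i _; have := sqr_sum_entry i A0 pA.
  by rewrite Az normr_le0 => /eqP ->; rewrite normr0 mul0r.
have [Bz|Bn0] := eqVneq B 0.
  rewrite Bz mulr0 big1 // => i _; have := sqr_sum_entry i B0 qB.
  by rewrite Bz normr_le0 => /eqP ->; rewrite normr0 mulr0.
have AB : 0 < 2 * (A * B).
  by rewrite mulr_gt0 // lt_neqAle eq_sym mulf_neq0 //= mulr_ge0.
rewrite -(ler_pM2l AB) mulr_sumr.
apply: (@le_trans _ _ (B ^+ 2 * (\sum_i p i ^+ 2) + A ^+ 2 * \sum_i q i ^+ 2)).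
  rewrite !mulr_sumr -big_split /=; apply: ler_sum => i _.
  have := sqr_ge0 (B * `|p i| - A * `|q i|).
  by rewrite -(real_normK (num_real (p i))) -(real_normK (num_real (q i))); nra.
apply: le_trans (lerD (ler_wpM2l (sqr_ge0 B) pA) (ler_wpM2l (sqr_ge0 A) qB)) _.
by rewrite le_eqVlt; apply/orP; left; apply/eqP; ring.
Qed.

(** On the unit sphere |<v_i - v_{i+1}, x>| <= 2, so all but one of the k factors of
    each power are bounded by 2, and Cauchy-Schwarz applies to the remaining
    factor against the increment of the coefficient. *)
Lemma chain_smooth v : (0 < d)%N -> 0 <= alpha -> orthonormal_upto v ->
  order_smooth k (alpha * (k.+1)`!%:R * 2 ^+ k.+1) (chain v).
Proof.
move=> d0 alpha0 ov u w; apply: opnorm_le => // x x1.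
rewrite (tform_nabla_ridge (fun i : 'I_n.+1 => chain_dir v i)
           is_derive_chain_profile).
(* The derivative of order k > 0 of the linear term is constant. *)
rewrite big_ord_recl [chain_profile _ _ _](_ : _ =
  chain_profile 0 k (dot (chain_dir v 0) w)); last first.
  by move: k_gt0 => /=; case: (k) => [|[]].
rewrite subrr mul0r add0r.
set E := enorm _; set C := alpha * _.
have E0 : 0 <= E by exact: sqrtr_ge0.
have C0 : 0 <= C by rewrite mulr_ge0.
have pE : \sum_(i < n) dot (v i - v i.+1) (u - w) ^+ 2 <= (2 * E) ^+ 2.
  by rewrite exprMn enorm_sqr -natrX; exact: sum_dot_diff_sqr.
have q4 : \sum_(i < n) dot (v i - v i.+1) x ^+ 2 <= 2 ^+ 2.
  by have := sum_dot_diff_sqr x ov; rewrite -enorm_sqr x1 expr1n mulr1 -natrX.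
apply: le_trans (ler_norm_sum _ _ _) _.
apply: (@le_trans _ _ (\sum_(i < n) C * 2 ^+ k.-1 *
   (`|dot (v i - v i.+1) (u - w)| * `|dot (v i - v i.+1) x|))).
  apply: ler_sum => i _.
  have -> : chain_profile (lift ord0 i) k = fun y => C * ppow 1 y.
    by apply/funext => y; rewrite /= subSnn /C -ffactnn ffactnSr subSnn muln1.
  move: (C) C0 => c c0; rewrite -mulrBr !normrM (ger0_norm c0) -!mulrA ler_wpM2l //.
  rewrite [leRHS]mulrCA -[`|dot _ (u - w)|]/`|dot (chain_dir v i.+1) (u - w)|.
  apply: ler_pM => //; first by rewrite linearB; exact: ppow1_lipschitz.
  rewrite normrX -[in leLHS](prednK k_gt0) exprSr ler_wpM2r //.
  rewrite lerXn2r ?nnegrE //.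
  exact: sqr_sum_entry (ler0n _ 2) q4.
rewrite -mulr_sumr (_ : C * 2 ^+ k.+1 * E = C * 2 ^+ k.-1 * (2 * E * 2)); last first.
  by rewrite -[in LHS](prednK k_gt0) !exprSr; ring.
apply: ler_wpM2l; first by rewrite mulr_ge0 // exprn_ge0.
by apply: sum_norm_mul_le => //; rewrite mulr_ge0.
Qed.

Lemma telescope_dot_diff v w t :
  \sum_(i < t) dot (v i - v i.+1) w = dot (v 0) w - dot (v t) w.
Proof.
elim: t => [|t IH]; first by rewrite big_ord0 subrr.
by rewrite big_ord_recr IH /= !(dotC _ w) linearB /=; ring.
Qed.

(** Powers of index at least t are only bounded below by 0, the others by their
    tangent at delta.  The slope of that tangent is beta / alpha, so the
    telescoping sum of its linear parts cancels the linear term of the chain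
    up to beta * <v_t, w>, which is 0. *)
Lemma chain_ge v w t (delta : R) : 0 <= alpha -> 0 <= delta ->
  beta = alpha * k.+1%:R * delta ^+ k -> (t <= n)%N -> dot (v t) w = 0 ->
  - (t%:R * (alpha * k%:R * delta ^+ k.+1)) <= chain v w.
Proof.
move=> alpha0 delta0 betaE tn vt; rewrite chainE.
have H : t%:R * (delta ^+ k.+1 - k.+1%:R * delta ^+ k * delta)
    + k.+1%:R * delta ^+ k * dot (v 0) w
    <= \sum_(i < n) ppow k.+1 (dot (v i - v i.+1) w).
  rewrite -(big_mkord xpredT (fun i => ppow k.+1 (dot (v i - v i.+1) w))).
  rewrite (big_cat_nat (n := t)) //= big_mkord -[leLHS]addr0 lerD //; last first.
    by apply: sumr_ge0 => i _; exact: ppow_ge0.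
  have -> : dot (v 0) w = \sum_(i < t) dot (v i - v i.+1) w.
    by rewrite telescope_dot_diff vt subr0.
  rewrite mulr_sumr -[t in t%:R]card_ord mulr_natl -sumr_const -big_split /=.
  apply: ler_sum => i _; case: (k) k_gt0 => // k' _.
  have := ppow_tangent k' (dot (v i - v i.+1) w) delta.
  rewrite !(ppow_nneg _ delta0); apply: le_trans.
  by rewrite le_eqVlt; apply/orP; left; apply/eqP; ring.
apply: le_trans (lerB (ler_wpM2l alpha0 H) (lexx _)).
rewrite le_eqVlt; apply/orP; left; apply/eqP.
by rewrite betaE exprS -natr1; ring.
Qed.

(** All arguments of the powers equal delta at such a point, so each tangent
    bound in [chain_ge] is an equality. *)
Lemma chain_at_minimizer v w (delta : R) : 0 <= delta ->
  beta = alpha * k.+1%:R * delta ^+ k ->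
  (forall i, (i <= n)%N -> dot (v i) w = (n - i)%:R * delta) ->
  chain v w = - (n%:R * (alpha * k%:R * delta ^+ k.+1)).
Proof.
move=> delta0 betaE vw; rewrite chainE vw // subn0 (eq_bigr (fun=> delta ^+ k.+1)).
  by rewrite sumr_const card_ord betaE -mulr_natl exprS -natr1; ring.
move=> [i ni] _ /=; rewrite (dotC _ w) linearB /= !(dotC w) !vw ?(ltnW ni) //.
rewrite -mulrBl -natrB; last by lia.
by rewrite (_ : (n - i - (n - i.+1) = 1)%N) ?mul1r ?ppow_nneg //; lia.
Qed.

End Chain.

(** * The resisting oracle *)

Section Adversary.
Variables (R : realType) (k : nat) (alg : algorithm R k).
Hypothesis k_gt0 : (0 < k)%N.

(** The matrix with the vectors of s as columns has rank less than d, so its left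
    kernel is nontrivial. *)
Lemma exists_unit_orthogonal d (s : seq 'rV[R]_d) : (size s < d)%N ->
  exists z : 'rV[R]_d, dot z z = 1 /\ forall y, y \in s -> dot z y = 0.
Proof.
move=> sd; pose M : 'M[R]_(d, size s) := \matrix_(i, j) s`_j 0 i.
have : kermx M != 0.
  rewrite kermx_eq0 /row_free neq_ltn; apply/orP; left.
  exact: leq_ltn_trans (rank_leq_col M) sd.
case/rowV0Pn => x /sub_kermxP xM x0.
have dx : 0 < dot x x.
  rewrite lt_neqAle dot_ge0 andbT eq_sym; apply: contra x0 => /eqP dx0.
  apply/eqP/rowP => i; rewrite mxE.
  have /psumr_eq0P H : forall i, true -> 0 <= x 0 i * x 0 i :> R.
    by move=> ? _; rewrite -expr2 sqr_ge0.
  by have /eqP := H dx0 i isT; rewrite mulf_eq0 orbb => /eqP.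
have ex : enorm x != 0 by rewrite -sqrf_eq0 enorm_sqr gt_eqF.
exists ((enorm x)^-1 *: x); split.
  rewrite linearZ /= dotC linearZ /= -enorm_sqr.
  by rewrite -[LHS]/((enorm x)^-1 * ((enorm x)^-1 * enorm x ^+ 2)); field.
move=> y /(nthP 0)[i si <-]; rewrite dotC linearZ /= dotC.
have := congr1 (fun A : 'rV_(size s) => A 0 (Ordinal si)) xM.
by rewrite !mxE => H; rewrite -[RHS](mulr0 (enorm x)^-1) -{}H;
   congr (_ * _); apply: eq_bigr => j _; rewrite mxE.
Qed.

(** Induction on the number m of directions already fixed.  The algorithm is run
    on the chain with v_m = v_{m+1} = ... = 0, which determines the queries
    w_0, ..., w_m; the new v_m is a unit vector orthogonal to them and to the
    earlier directions.  By [chain_local] the oracle gives the same answers for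
    the old and the new chain at w_0, ..., w_{m-1}, so the queries up to w_m
    do not change. *)
Lemma adversary d n (alpha beta : R) m : (m <= n)%N -> (2 * n <= d)%N ->
  exists v : nat -> 'rV[R]_d,
    orthonormal_upto m v /\
    forall t i, (t <= i)%N ->
      dot (v i) (iterate alg (chain k n alpha beta v) t.+1) = 0.
Proof.
move=> mn nd; elim: m mn => [|m IH] mn.
  by exists (fun=> 0); split=> [|t i _]; [split|rewrite dotC linear0].
have [v [[vv v0] vw]] := IH (ltnW mn).
pose w (t : nat) := iterate alg (chain k n alpha beta v) t.+1.
have [|z [z1 zs]] := @exists_unit_orthogonal d
    ([seq v i | i <- iota 0 m] ++ [seq w t | t <- iota 0 m.+1]).
  by rewrite size_cat !size_map !size_iota; lia.
have zv i : (i < m)%N -> dot z (v i) = 0.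
  by move=> im; apply: zs; rewrite mem_cat map_f // mem_iota.
have zw t : (t <= m)%N -> dot z (w t) = 0.
  move=> tm; apply: zs; rewrite mem_cat orbC map_f // mem_iota.
  by rewrite add0n ltnS.
pose v' i := if i == m then z else v i.
have v'E i : i != m -> v' i = v i by rewrite /v' => /negbTE ->.
have v'w t i : (t <= m)%N -> (t <= i)%N -> dot (v' i) (w t) = 0.
  by move=> tm ti; rewrite /v'; case: eqP => _; [exact: zw|exact: vw].
have same t : (t <= m)%N ->
    transcript alg (chain k n alpha beta v') t =
    transcript alg (chain k n alpha beta v) t.
  elim: t => [//|t IHt] tm /=; rewrite IHt ?(ltnW tm) //; congr rcons.
  apply: (@chain_local R d k n alpha beta k_gt0 v' v t) => i it.
  - by rewrite v'E // neq_ltn (leq_ltn_trans it tm).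
  - exact: v'w (ltnW tm) it.
  - exact: vw.
have lt_m i : (i < m.+1)%N -> i != m -> (i < m)%N.
  by move=> im ne; rewrite ltn_neqAle ne -ltnS.
exists v'; split; first split.
- move=> i j; rewrite /v'.
  case: (eqVneq i m) => [->|im] im'; case: (eqVneq j m) => [->|jm] jm'.
  + by rewrite z1.
  + by rewrite zv ?lt_m.
  + by rewrite dotC zv ?lt_m // (negbTE im).
  + by rewrite vv ?lt_m.
- by move=> i mi; rewrite v'E ?v0 ?(ltnW mi) // gtn_eqF.
move=> t i ti; have [tm|mt] := leqP t m.
  by rewrite /iterate /= same //; exact: v'w.
have mi := leq_trans mt ti.
by rewrite v'E ?gtn_eqF // v0 ?(ltnW mi) // dotC linear0.
Qed.

End Adversary.

(** * Choice of the length of the chain *)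

(** Since N <= 2 X, the power N^(3k+1) is at most M^2 / 32^(3k+1): the exponent
    2/(3k+1) is chosen to produce M^2, and the factor 64 to leave 32^(3k+1),
    which dominates 32^(k+1). *)
Lemma chain_length_bound (R : realType) (k : nat) (M : R) : 0 < M ->
  let X := 64^-1 * M `^ (2 / (3 * k + 1)%:R) in
  1 < X -> 32 ^+ k.+1 * (Num.truncn X).+1%:R ^+ (3 * k + 1) < M ^+ 2.
Proof.
move=> M0 X X1; set N := (Num.truncn X).+1.
have N2X : N%:R < 2 * X.
  have /andP[+ _] := truncn_itv (ltW (lt_trans ltr01 X1)).
  by rewrite /N -natr1; lra.
have XM : (64 * X) ^+ (3 * k + 1) = M ^+ 2.
  rewrite /X mulrA divff ?pnatr_eq0 // mul1r -[LHS]powR_mulrn ?powR_ge0 // -powRrM.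
  by rewrite divfK ?pnatr_eq0 ?addn1 // powR_mulrn // ltW.
have -> : M ^+ 2 = 32 ^+ (3 * k + 1) * (2 * X) ^+ (3 * k + 1).
  by rewrite -XM -exprMn; congr (_ ^+ _); ring.
apply: (@le_lt_trans _ _ (32 ^+ (3 * k + 1) * N%:R ^+ (3 * k + 1))).
  by rewrite ler_wpM2r ?exprn_ge0 // ler_eXn2l ?ltr1n //; lia.
by rewrite ltr_pM2l ?exprn_gt0 // ltrXn2r ?addn1.
Qed.

(** Squaring removes the square root in delta.  The square A^2 of the right-hand
    side satisfies A^2 32^(k+1) N^(3k+1) = k^4 M^2 eps^2, where
    32^(k+1) = (2^(k+1))^2 8^(k+1) collects the constant of [chain_smooth] and
    the length 2N of the chain. *)
Lemma gap_exceeds (R : realType) (k N : nat) (mu D eps delta M : R) :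
  (0 < k)%N -> (0 < N)%N -> 0 < mu -> 0 < D -> 0 < eps -> 0 < delta ->
  M = (mu * D ^+ k.+1) / ((k.+1)`!%:R * k%:R * eps) ->
  delta ^+ 2 * (2 * N)%:R ^+ 3 = D ^+ 2 ->
  32 ^+ k.+1 * N%:R ^+ (3 * k + 1) < M ^+ 2 ->
  eps < N%:R * (mu / ((k.+1)`!%:R * 2 ^+ k.+1) * k%:R * delta ^+ k.+1).
Proof.
move=> k0 N0 mu0 D0 eps0 delta0 ME dD H.
set A := N%:R * _.
have f0 : 0 < (k.+1)`!%:R :> R by rewrite ltr0n fact_gt0.
have kR : 1 <= k%:R :> R by rewrite ler1n.
have NR : 0 < N%:R :> R by rewrite ltr0n.
have P0 : 0 < 2 ^+ k.+1 :> R by rewrite exprn_gt0.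
have A0 : 0 < A.
  by rewrite /A mulr_gt0 // mulr_gt0 ?exprn_gt0 // mulr_gt0 ?ltr0n // divr_gt0 // mulr_gt0.
have dD' : (delta ^+ k.+1) ^+ 2 *
    (8 ^+ k.+1 * (N%:R ^+ (3 * k + 1) * N%:R ^+ 2)) = (D ^+ k.+1) ^+ 2.
  rewrite -exprD (_ : (3 * k + 1 + 2 = 3 * k.+1)%N); last by lia.
  rewrite exprM -!exprMn -[delta ^+ _ ^+ _]exprM mulnC exprM -exprMn.
  rewrite -[RHS]exprM [(k.+1 * 2)%N]mulnC exprM -dD; congr (_ ^+ _).
  by rewrite natrM; ring.
have key : A ^+ 2 * (32 ^+ k.+1 * N%:R ^+ (3 * k + 1)) =
    k%:R ^+ 4 * M ^+ 2 * eps ^+ 2.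
  have -> : 32 ^+ k.+1 = (2 ^+ k.+1) ^+ 2 * 8 ^+ k.+1 :> R.
    by rewrite -exprM mulnC exprM -exprMn; congr (_ ^+ _); ring.
  rewrite ME /A.
  (* Powers with exponents depending on k become atoms for [field]. *)
  move: (D ^+ k.+1) (delta ^+ k.+1) (2 ^+ k.+1) (8 ^+ k.+1)
    (N%:R ^+ (3 * k + 1)) dD' P0 => q p P E NN pq P0.
  transitivity (mu ^+ 2 * k%:R ^+ 2 / (k.+1)`!%:R ^+ 2
                * (p ^+ 2 * (E * (NN * N%:R ^+ 2)))).
    by field; rewrite !gt_eqF.
  by rewrite pq; field; rewrite !gt_eqF // (lt_le_trans ltr01).
rewrite -(@ltr_pXn2r _ 2) ?nnegrE ?(ltW A0) ?(ltW eps0) //.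
have M2 : 0 < M ^+ 2.
  by apply: le_lt_trans H; rewrite mulr_ge0 ?exprn_ge0.
rewrite -(ltr_pM2r M2); apply: (@le_lt_trans _ _ (k%:R ^+ 4 * M ^+ 2 * eps ^+ 2)).
  have k4 : 1 <= k%:R ^+ 4 :> R by exact: exprn_ege1.
  have Me : 0 <= M ^+ 2 * eps ^+ 2 by apply: mulr_ge0 (ltW M2) (sqr_ge0 _).
  by rewrite [leLHS]mulrC -[leRHS]mulrA ler_peMl.
by rewrite -key ltr_pM2l ?exprn_gt0.
Qed.

(** * The lower bound *)

Theorem theorem3 (R : realType) :
  exists2 c : R, 0 < c &
  forall (k : nat) (mu D eps : R) (alg : algorithm R k),
    (0 < k)%N -> 0 < mu -> 0 < D -> 0 < eps ->
  exists (d : nat) (f : 'rV[R]_d -> R^o) (wstar : 'rV[R]_d),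
    (0 < d)%N /\
    convex_function [set: convex_lmodType 'rV[R]_d] f /\
    times_differentiable k f /\
    order_smooth k mu f /\
    (forall w : 'rV[R]_d, f wstar <= f w) /\
    enorm (init_point alg d - wstar) <= D /\
    forall T : nat, (0 < T)%N ->
      f (iterate alg f T) - f wstar <= eps ->
      c * ((mu * D ^+ k.+1) / ((k.+1)`!%:R * k%:R * eps))
            `^ (2 / (3 * k + 1)%:R)
        <= T%:R.
Proof.
exists 64^-1; first by rewrite invr_gt0.
move=> k mu D eps alg k0 mu0 D0 eps0.
set M := mu * D ^+ k.+1 / _; set X := 64^-1 * _.
have M0 : 0 < M.
  apply: divr_gt0; first by rewrite mulr_gt0 ?exprn_gt0.
  by rewrite mulr_gt0 // mulr_gt0 ?ltr0n ?fact_gt0.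
set N := (Num.truncn X).+1; pose n := (2 * N)%N.
have n0 : 0 < n%:R :> R by rewrite ltr0n muln_gt0.
pose alpha := mu / ((k.+1)`!%:R * 2 ^+ k.+1).
have [delta delta0 deltaD] :
    exists2 delta : R, 0 < delta & delta ^+ 2 * n%:R ^+ 3 = D ^+ 2.
  exists (D / Num.sqrt (n%:R ^+ 3)).
    by rewrite divr_gt0 ?sqrtr_gt0 ?exprn_gt0.
  rewrite exprMn exprVn sqr_sqrtr ?exprn_ge0 ?(ltW n0) // divfK //.
  by rewrite expf_neq0 // gt_eqF.
pose beta := alpha * k.+1%:R * delta ^+ k.
have alpha0 : 0 < alpha.
  by rewrite divr_gt0 // mulr_gt0 ?exprn_gt0 ?ltr0n ?fact_gt0.
(* The first N queries do not reach the second half of the chain, and what they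
   leave there is the gap. *)
have [v [ov vw]] := adversary alg k0 alpha beta (leqnn n) (leqnn (2 * n)).
have [vv v0] := ov.
pose f := chain k n alpha beta v.
pose y := \sum_(i < n) ((n - i)%:R * delta) *: v i.
pose wstar := init_point alg (2 * n) + y.
have vy i : (i <= n)%N -> dot (v i) y = (n - i)%:R * delta.
  rewrite leq_eqVlt => /predU1P[->|ni].
    by rewrite v0 // dotC linear0 subnn mul0r.
  exact: (dot_orthonormal_sum (fun j => (n - j)%:R * delta) vv ni).
have vstar i : (i <= n)%N -> dot (v i) wstar = (n - i)%:R * delta.
  by move=> ni; rewrite /wstar linearD /= (vw 0%N i) // add0r vy.
have fstar : f wstar = - (n%:R * (alpha * k%:R * delta ^+ k.+1)).
  exact: chain_at_minimizer (ltW delta0) _ vstar.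
exists (2 * n)%N, f, wstar; split; first by rewrite !muln_gt0.
split; first exact: chain_convex (ltW alpha0).
split; first exact: chain_times_differentiable.
split.
  rewrite [mu](_ : _ = alpha * (k.+1)`!%:R * 2 ^+ k.+1).
    by apply: chain_smooth; rewrite ?muln_gt0 ?(ltW alpha0).
  rewrite /alpha; field.
  by rewrite expf_neq0 ?pnatr_eq0 // -lt0n fact_gt0.
split.
  move=> w; rewrite fstar.
  apply: chain_ge (ltW alpha0) (ltW delta0) _ (leqnn n) _ => //.
  by rewrite v0 // dotC linear0.
split.
  rewrite -(@ler_pXn2r _ 2) ?nnegrE ?(ltW D0) ?sqrtr_ge0 // enorm_sqr.
  have -> : init_point alg (2 * n) - wstar = - y.
    by rewrite /wstar opprD addrA subrr add0r.
  rewrite linearN /= dotC linearN /= opprK.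
  have -> : dot y y = \sum_(i < n) dot y (((n - i)%:R * delta) *: v i).
    by rewrite [in X in dot _ X]/y linear_sum.
  rewrite -deltaD.
  apply: (@le_trans _ _ (\sum_(i < n) (n%:R * delta) ^+ 2)).
    apply: ler_sum => i _; rewrite linearZ /= dotC vy; last exact: ltnW.
    rewrite -[leLHS]/((n - i)%:R * delta * ((n - i)%:R * delta)) -expr2.
    rewrite lerXn2r ?nnegrE ?mulr_ge0 ?(ltW delta0) ?ler0n //.
    by rewrite ler_wpM2r ?(ltW delta0) // ler_nat leq_subr.
  rewrite sumr_const card_ord -mulr_natl.
  by rewrite le_eqVlt; apply/orP; left; apply/eqP; ring.
move=> T T0; apply: contraTT; rewrite -!ltNge => TX.
(* The inequality is trivial when X <= 1; here T < X forces X > 1. *)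
have X1 : 1 < X by apply: le_lt_trans TX; rewrite ler1n.
have TN : (T <= N)%N.
  by rewrite -(ler_nat R); apply: ltW (lt_trans TX (truncnS_gt X)).
have big : eps < N%:R * (alpha * k%:R * delta ^+ k.+1).
  have NM := chain_length_bound M0 X1.
  have gapN := gap_exceeds k0 (ltn0Sn _ : (0 < N)%N) mu0 D0 eps0 delta0
    (erefl M) deltaD.
  exact: gapN NM.
apply: lt_le_trans big _; rewrite fstar opprK.
have NT : (N + T.-1 <= n)%N.
  by rewrite /n mul2n -addnn leq_add2l (leq_trans (leq_pred T)).
have Tn : (T.-1 <= n)%N by exact: leq_trans (leq_addl _ _) NT.
have := chain_ge (beta := beta) k0 (ltW alpha0) (ltW delta0) erefl Tn
  (vw T.-1 T.-1 (leqnn _)).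
rewrite prednK // -/f; set A := alpha * _ * _ => fT.
have A0 : 0 <= A.
  rewrite /A; apply: mulr_ge0; last by rewrite exprn_ge0 ?(ltW delta0).
  by apply: mulr_ge0 (ltW alpha0) _.
apply: le_trans (lerD fT (lexx _)); rewrite addrC -mulrBl ler_wpM2r //.
by rewrite lerBrDr -natrD ler_nat.
Qed.
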